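(* Let $\mathbb{A}=(\mathcal{A},\leq,\to,\Sigma)$ be an implicative algebra, let $\mathsf{P}:\mathsf{Set}^{\mathrm{op}}\to\mathsf{Hey}$ be its implicative tripos, let $I$ be a set, and let $\varphi$ be a predicate of $\mathsf{P}(I)$ (represented by a function $\varphi:I\to\mathcal{A}$). Then: 1. $\varphi$ is a supercompact predicate ($\mathbf{SK_p}$) if and only if the family $(\varphi(i))_{i\in I}$ is supercompact ($\mathbf{SK}$); 2. $\varphi$ is a functionally supercompact predicate ($\mathbf{fSK_p}$) if and only if the family $(\varphi(i))_{i\in I}$ is functionally supercompact ($\mathbf{fSK}$); 3. $\varphi$ is a weakly functionally supercompact predicate ($\mathbf{wfSK_p}$) if and only if the family $(\varphi(i))_{i\in I}$ is weakly functionally supercompact ($\mathbf{wfSK}$).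
   Context: Implicative algebras. An implicative algebra $\mathbb{A}=(\mathcal{A},\leq,\to,\Sigma)$ is a complete lattice $(\mathcal{A},\leq)$ with a binary operation $\to$ (associating to the right) such that (i) $a'\leq a$ and $b\leq b'$ imply $a\to b\leq a'\to b'$, and (ii) $a\to\bigwedge_{b\in B}b=\bigwedge_{b\in B}(a\to b)$ for all $a\in\mathcal{A}$, $B\subseteq\mathcal{A}$; together with a separator $\Sigma\subseteq\mathcal{A}$, i.e. a subset that is upward closed, contains $\bigwedge_{a,b}(a\to b\to a)$ and $\bigwedge_{a,b,c}((a\to b\to c)\to(a\to b)\to a\to c)$, and satisfies: $a\to b\in\Sigma$ and $a\in\Sigma$ imply $b\in\Sigma$. $\top,\bot$ are the maximum and minimum. Define $$a\times b:=\bigwedge_{x\in\mathcal{A}}((a\to(b\to x))\to x),\qquad \exists_{i\in I}c_i:=\bigwedge_{x\in\mathcal{A}}\Big(\bigwedge_{i\in I}(c_i\to x)\to x\Big),$$ and for a set $J$ and $j,j'\in J$: $\delta_J(j,j'):=\bigwedge_{x\in\mathcal{A}}((\top\to x)\to x)$ if $j=j'$, and $\delta_J(j,j'):=\top\to\bot$ if $j\neq j'$. Families. A family $(b^i_j)_{i\in I,j\in J}$ is $\times$-functional if $\bigwedge_{i\in I}\bigwedge_{j,j'\in J}(b^i_j\times b^i_{j'}\to\delta_J(j,j'))\in\Sigma$. A family $(a_i)_{i\in I}$ of elements of $\mathcal{A}$ is: - $\mathbf{SK}$ if for every family of families $((b^i_j)_{j\in J_i})_{i\in I}$ of elements of $\mathcal{A}$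 with $\bigwedge_{i\in I}(a_i\to\exists_{j\in J_i}b^i_j)\in\Sigma$ there is $f\in\prod_{i\in I}J_i$ with $\bigwedge_{i\in I}(a_i\to b^i_{f(i)})\in\Sigma$; - $\mathbf{fSK}$ if for every $\times$-functional family $(b^i_j)_{i\in I,j\in J}$ with $\bigwedge_{i\in I}(a_i\to\exists_{j\in J}b^i_j)\in\Sigma$ there is a unique $f:I\to J$ with $\bigwedge_{i\in I}(a_i\to b^i_{f(i)})\in\Sigma$; - $\mathbf{wfSK}$ if the same holds with ''a unique $f$'' replaced by ''some $f$''. These properties depend only on the class of $i\mapsto a_i$ in $\mathsf{P}(I)$ defined below. Implicative tripos. For a set $I$, $\mathsf{P}(I)$ is the posetal reflection of $\mathcal{A}^I$ preordered by: $\varphi\vdash\psi$ iff $\bigwedge_{i\in I}(\varphi(i)\to\psi(i))\in\Sigma$. It is a Heyting algebra with order written $\leq$ and meet $\wedge$ (represented by the pointwise $\times$). For $f:I\to X$, $\mathsf{P}_f:\mathsf{P}(X)\to\mathsf{P}(I)$ is precomposition with $f$; its left adjoint $\exists_f$ is represented by $(\exists_f\varphi)(x)=\exists_{i\in f^{-1}(x)}\varphi(i)$. Predicates are identified with representing functions. For a set $X$ with diagonal $\Delta_X$, $\delta_X:=\exists_{\Delta_X}(\top)\in\mathsf{P}(X\times X)$. Predicates. A predicate $\phi\in\mathsf{P}(I\times J)$ is functional if $\mathsf{P}_{\langle\pi_1,\pi_2\rangle}(\phi)\wedge\mathsf{P}_{\langle\pi_1,\pi_3\rangle}(\phi)\leq\mathsf{P}_{\langle\pi_2,\pi_3\rangle}(\delta_J)$,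 the projections being from $I\times J\times J$. A predicate $\varphi\in\mathsf{P}(I)$ is: - $\mathbf{SK_p}$ if whenever $\varphi\leq\exists_f(\psi)$ with $f:J\to I$ and $\psi\in\mathsf{P}(J)$, there is $g:I\to J$ with $\varphi\leq\mathsf{P}_g(\psi)$ and $f\circ g=\mathrm{id}_I$; - $\mathbf{fSK_p}$ if for every set $J$ and functional $\phi\in\mathsf{P}(I\times J)$ with $\varphi\leq\exists_{\pi_I}(\phi)$ there is a unique $f:I\to J$ with $\varphi\leq\mathsf{P}_{\langle\mathrm{id}_I,f\rangle}(\phi)$; - $\mathbf{wfSK_p}$ if the same holds with ''a unique $f$'' replaced by ''some $f$''. *)

(* Defs.v *)
From HB Require Import structures.
#[warnings="-notation-overridden"]
From mathcomp Require Import all_boot all_order.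
From mathcomp Require Import boolp classical_sets.

Set Implicit Arguments.
Unset Strict Implicit.
Unset Printing Implicit Defensive.

Import Order.TTheory.
Local Open Scope quotient_scope.
Local Open Scope classical_set_scope.
Local Open Scope order_scope.

(* Complete lattices. [infimums B] is the library's set of greatest lower
   bounds of [B]. *)
HB.mixin Record TBLattice_isComplete d T of Order.TBLattice d T := {
  bigmeet : set T -> T;
  bigmeetP : forall B : set T, infimums B (bigmeet B)
}.

#[short(type="completeLatticeType")]
HB.structure Definition CompleteLattice d :=
  { T of TBLattice_isComplete d T & Order.TBLattice d T }.

Notation "\Meet_ ( i 'in' D ) F" := (bigmeet ((fun i => F) @` D))
  (at level 65, F at level 65, i name,
   format "\Meet_ ( i  'in'  D )  F") : order_scope.
Notation "\Meet_ ( i : I ) F" := (bigmeet ((fun i : I => F) @` [set: I]))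
  (at level 65, F at level 65, i name) : order_scope.
Notation "\Meet_ i F" := (bigmeet (range (fun i => F)))
  (at level 65, i name, F at level 65, format "\Meet_ i  F") : order_scope.

HB.mixin Record CompleteLattice_isImplicative d T of CompleteLattice d T := {
  imp : T -> T -> T;
  le_imp : forall a a' b b' : T, a' <= a -> b <= b' -> imp a b <= imp a' b';
  imp_bigmeet : forall (a : T) (B : set T),
    imp a (bigmeet B) = \Meet_(b in B) imp a b;
  separator : set T;
  separator_up : forall a b : T, a <= b -> separator a -> separator b;
  separator_K : separator (\Meet_(a : T) \Meet_(b : T) imp a (imp b a));
  separator_S : separator (\Meet_(a : T) \Meet_(b : T) \Meet_(c : T)
    imp (imp a (imp b c)) (imp (imp a b) (imp a c)));
  separator_mp : forall a b : T, separator (imp a b) -> separator a -> separator b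
}.

#[short(type="implicativeAlgebraType")]
HB.structure Definition ImplicativeAlgebra d :=
  { T of CompleteLattice_isImplicative d T & CompleteLattice d T }.

Notation "a ~> b" := (imp a b)
  (at level 60, right associativity) : order_scope.

Section Operations.
Context {d : Order.disp_t} {A : implicativeAlgebraType d}.
Implicit Types a b x : A.

Definition times a b : A := \Meet_(x : A) ((a ~> b ~> x) ~> x).

Definition exists_in (I : Type) (D : set I) (c : I -> A) : A :=
  \Meet_(x : A) ((\Meet_(i in D) (c i ~> x)) ~> x).

Definition exists_all (I : Type) (c : I -> A) : A := exists_in [set: I] c.

Definition deltaA (J : Type) (j j' : J) : A :=
  if pselect (j = j') then \Meet_(x : A) ((\top ~> x) ~> x) else \top ~> \bot.

End Operations.

Section Families.
Context {d : Order.disp_t} {A : implicativeAlgebraType d}.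

Definition times_functional (I J : Type) (b : I -> J -> A) : Prop :=
  separator (\Meet_(i : I) \Meet_(j : J) \Meet_(j' : J)
    (times (b i j) (b i j') ~> deltaA j j')).

Definition SK (I : Type) (a : I -> A) : Prop :=
  forall (J : I -> Type) (b : forall i, J i -> A),
    separator (\Meet_(i : I) (a i ~> exists_all (b i))) ->
    exists f : forall i, J i, separator (\Meet_(i : I) (a i ~> b i (f i))).

Definition fSK (I : Type) (a : I -> A) : Prop :=
  forall (J : Type) (b : I -> J -> A), times_functional b ->
    separator (\Meet_(i : I) (a i ~> exists_all (b i))) ->
    exists! f : I -> J, separator (\Meet_(i : I) (a i ~> b i (f i))).

Definition wfSK (I : Type) (a : I -> A) : Prop :=
  forall (J : Type) (b : I -> J -> A), times_functional b ->
    separator (\Meet_(i : I) (a i ~> exists_all (b i))) ->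
    exists f : I -> J, separator (\Meet_(i : I) (a i ~> b i (f i))).

End Families.

Section SeparatorTheory.
Context {d : Order.disp_t} {A : implicativeAlgebraType d}.

Lemma bigmeet_lb (X : Type) (F : X -> A) x : \Meet_i F i <= F x.
Proof. by have [+ _] := bigmeetP (range F); apply; exists x. Qed.

Lemma bigmeet_glb (X : Type) (F : X -> A) a :
  (forall x, a <= F x) -> a <= \Meet_i F i.
Proof.
by move=> aF; have [_] := bigmeetP (range F); apply=> _ [x _ <-].
Qed.

Lemma bigmeet_in_lb (X : Type) (D : set X) (F : X -> A) x :
  D x -> \Meet_(i in D) F i <= F x.
Proof. by move=> Dx; have [+ _] := bigmeetP (F @` D); apply; exists x. Qed.

Lemma bigmeet_in_glb (X : Type) (D : set X) (F : X -> A) a :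
  (forall x, D x -> a <= F x) -> a <= \Meet_(i in D) F i.
Proof.
by move=> aF; have [_] := bigmeetP (F @` D); apply=> _ [x Dx <-]; exact: aF.
Qed.

Lemma imp_glb (X : Type) (D : set X) (F : X -> A) a b :
  (forall x, D x -> b <= a ~> F x) -> b <= a ~> \Meet_(i in D) F i.
Proof.
move=> h; rewrite imp_bigmeet.
have [_] := bigmeetP (imp a @` (F @` D)); apply=> _ [_ [x Dx <-] <-].
exact: h.
Qed.

Definition valid (X : Type) (F : X -> A) : Prop := separator (\Meet_x F x).

Lemma valid_reindex (X Y : Type) (F : X -> A) (G : Y -> A) :
  (forall y, exists x, F x <= G y) -> valid F -> valid G.
Proof.
move=> h; apply: separator_up; apply: bigmeet_glb => y.
by have [x] := h y; apply: le_trans; exact: bigmeet_lb.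
Qed.

Lemma valid_le (X : Type) (F G : X -> A) :
  (forall x, F x <= G x) -> valid F -> valid G.
Proof. by move=> h; apply: valid_reindex => x; exists x. Qed.

Lemma valid_mp (X : Type) (F G : X -> A) :
  valid (fun x => F x ~> G x) -> valid F -> valid G.
Proof.
move=> FG; apply: separator_mp; apply: separator_up FG.
apply: imp_glb => x _; apply: le_trans (bigmeet_lb _ x) _.
by apply: le_imp => //; exact: bigmeet_lb.
Qed.

Lemma valid_K (X : Type) (a b : X -> A) : valid (fun x => a x ~> b x ~> a x).
Proof.
apply: separator_up separator_K; apply: bigmeet_glb => x.
by apply: le_trans (bigmeet_lb _ (a x)) _; apply: (bigmeet_lb _ (b x)).
Qed.

Lemma valid_S (X : Type) (a b c : X -> A) :
  valid (fun x => (a x ~> b x ~> c x) ~> (a x ~> b x) ~> a x ~> c x).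
Proof.
apply: separator_up separator_S; apply: bigmeet_glb => x.
apply: le_trans (bigmeet_lb _ (a x)) _; apply: le_trans (bigmeet_lb _ (b x)) _.
exact: (bigmeet_lb _ (c x)).
Qed.

Section Rules.
Variable X : Type.
Implicit Types a b c e p q : X -> A.

Lemma valid_weak a p : valid p -> valid (fun x => a x ~> p x).
Proof. exact/valid_mp/valid_K. Qed.

Lemma valid_app a p q : valid (fun x => a x ~> p x ~> q x) ->
  valid (fun x => a x ~> p x) -> valid (fun x => a x ~> q x).
Proof. by move=> h; apply: valid_mp; apply: valid_mp h; exact: valid_S. Qed.

Lemma valid_app2 a b p q : valid (fun x => a x ~> b x ~> p x ~> q x) ->
  valid (fun x => a x ~> b x ~> p x) -> valid (fun x => a x ~> b x ~> q x).
Proof.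
move=> h; apply: valid_app; apply: valid_app h; apply: valid_weak.
exact: valid_S.
Qed.

Lemma valid_id a : valid (fun x => a x ~> a x).
Proof. exact: (valid_app (valid_K a (fun x => a x ~> a x)) (valid_K a a)). Qed.

Lemma valid_trans a b c : valid (fun x => a x ~> b x) ->
  valid (fun x => b x ~> c x) -> valid (fun x => a x ~> c x).
Proof. by move=> ab bc; apply: valid_app ab; exact: valid_weak. Qed.

Lemma valid_ev a b : valid (fun x => a x ~> (a x ~> b x) ~> b x).
Proof.
apply: (@valid_app2 _ _ a); first by apply: valid_weak; exact: valid_id.
exact: valid_K.
Qed.

Lemma valid_ev1 p q : valid p -> valid (fun x => (p x ~> q x) ~> q x).
Proof. exact/valid_mp/valid_ev. Qed.

End Rules.
End SeparatorTheory.

Section Entailment.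
Context {d : Order.disp_t} {A : implicativeAlgebraType d}.
Variable I : Type.
Implicit Types phi psi chi : I -> A.

Definition entails phi psi : bool :=
  `[< separator (\Meet_(i : I) (phi i ~> psi i)) >].

Definition entails_equiv phi psi := entails phi psi && entails psi phi.

Lemma entailsP phi psi :
  reflect (valid (fun i => phi i ~> psi i)) (entails phi psi).
Proof. exact: asboolP. Qed.

Lemma entails_refl : reflexive entails.
Proof. by move=> phi; apply/entailsP; exact: valid_id. Qed.

Lemma entails_trans : transitive entails.
Proof.
move=> psi phi chi /entailsP h /entailsP k; apply/entailsP.
exact: valid_trans h k.
Qed.

Lemma entails_equiv_refl : reflexive entails_equiv.
Proof. by move=> phi; rewrite /entails_equiv entails_refl. Qed.

Lemma entails_equiv_sym : symmetric entails_equiv.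
Proof. by move=> phi psi; rewrite /entails_equiv andbC. Qed.

Lemma entails_equiv_trans : transitive entails_equiv.
Proof.
move=> psi phi chi /andP[h1 h2] /andP[k1 k2]; apply/andP; split.
  exact: entails_trans h1 k1.
exact: entails_trans k2 h2.
Qed.

Canonical entails_equiv_equiv := EquivRel entails_equiv
  entails_equiv_refl entails_equiv_sym entails_equiv_trans.

Lemma entails_times phi psi chi :
  entails phi (fun i => times (psi i) (chi i)) =
  entails phi psi && entails phi chi.
Proof.
have l (a b : I -> A) : valid (fun i => times (a i) (b i) ~> a i).
  have /valid_ev1 := valid_K a b => /(_ a); apply: valid_le => i.
  by apply: le_imp => //; apply: (bigmeet_lb _ (a i)).
have r (a b : I -> A) : valid (fun i => times (a i) (b i) ~> b i).
  have /valid_ev1 : valid (fun i : I => a i ~> b i ~> b i).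
    by apply: valid_weak; exact: valid_id.
  move=> /(_ b); apply: valid_le => i.
  by apply: le_imp => //; apply: (bigmeet_lb _ (b i)).
apply/entailsP/andP => [h|[/entailsP h /entailsP k]].
  split; apply/entailsP; last exact: valid_trans h (r _ _).
  exact: valid_trans h (l _ _).
have {}h : valid (fun i : I * A => phi i.1 ~> psi i.1).
  by apply: valid_reindex h => i; exists i.1.
have {}k : valid (fun i : I * A => phi i.1 ~> chi i.1).
  by apply: valid_reindex k => i; exists i.1.
have {}h : valid (fun i : I * A => phi i.1 ~>
    (psi i.1 ~> chi i.1 ~> i.2) ~> chi i.1 ~> i.2).
  by apply: valid_trans h _; exact: valid_ev.
have {h k} : valid (fun i : I * A => phi i.1 ~>
    (psi i.1 ~> chi i.1 ~> i.2) ~> i.2).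
  apply: valid_app2 h _; apply: valid_trans k _; exact: valid_K.
apply: separator_up; apply: bigmeet_glb => i; apply: imp_glb => x _.
exact: (bigmeet_lb _ (i, x)).
Qed.

End Entailment.

Lemma entails_exists d (A : implicativeAlgebraType d) (I X : Type)
    (f : I -> X) (phi : I -> A) (psi : X -> A) :
  entails (fun x => exists_in (f @^-1` [set x]) phi) psi =
  entails phi (psi \o f).
Proof.
apply/entailsP/entailsP => h.
  have {}h : valid (fun i : I => exists_in (f @^-1` [set f i]) phi ~> psi (f i)).
    by apply: valid_reindex h => i; exists (f i).
  apply: valid_trans h; have := valid_ev (fun i : I * A => phi i.1) snd.
  apply: separator_up; apply: bigmeet_glb => i; apply: imp_glb => x _.
  apply: le_trans (bigmeet_lb _ (i, x)) _; do 2!apply: le_imp => //.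
  exact: bigmeet_in_lb.
have /valid_ev1 : valid (fun x => \Meet_(i in f @^-1` [set x]) (phi i ~> psi x)).
  apply: separator_up h; apply: bigmeet_glb => x.
  by apply: bigmeet_in_glb => i <-; apply: (bigmeet_lb _ i).
move=> /(_ psi); apply: valid_le => x; apply: le_imp => //.
exact: (bigmeet_lb _ (psi x)).
Qed.

(* P(I): the posetal reflection of the preorder [entails] on A^I. *)
Definition tripos d (A : implicativeAlgebraType d) (I : Type) : Type :=
  {eq_quot @entails_equiv d A I}.

HB.instance Definition _ d (A : implicativeAlgebraType d) (I : Type) :=
  Choice.on (tripos A I).
HB.instance Definition _ d (A : implicativeAlgebraType d) (I : Type) :=
  EqQuotient.on (tripos A I).

Section TriposOrder.
Context {d : Order.disp_t} {A : implicativeAlgebraType d} {I : Type}.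
Implicit Types (phi psi : I -> A) (p q r : tripos A I).

Definition predicate phi : tripos A I := \pi phi.

Lemma predicate_eq phi psi :
  (predicate phi == predicate psi) = entails phi psi && entails psi phi.
Proof. by rewrite /predicate (@pi_eq_quot _ _ (tripos A I)). Qed.

Definition tripos_le p q : bool := entails (repr p) (repr q).
Definition tripos_meet p q : tripos A I :=
  predicate (fun i => times (repr p i) (repr q i)).

Lemma predicateK p : predicate (repr p) = p.
Proof. exact: reprK. Qed.

Lemma tripos_leE phi psi :
  tripos_le (predicate phi) (predicate psi) = entails phi psi.
Proof.
have h chi : entails (repr (predicate chi)) chi && entails chi (repr (predicate chi)).
  by rewrite -predicate_eq predicateK.
have /andP[p1 p2] := h phi; have /andP[q1 q2] := h psi.
apply/idP/idP => k.
  exact: entails_trans (entails_trans p2 k) q1.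
exact: entails_trans (entails_trans p1 k) q2.
Qed.

Lemma tripos_le_refl : reflexive tripos_le.
Proof. by move=> p; exact: entails_refl. Qed.

Lemma tripos_le_anti : antisymmetric tripos_le.
Proof.
by move=> p q h; rewrite -(predicateK p) -(predicateK q); apply/eqP; rewrite predicate_eq.
Qed.

Lemma tripos_le_trans : transitive tripos_le.
Proof. by move=> q p r; exact: entails_trans. Qed.

HB.instance Definition _ := Order.Le_isPOrder.Build d (tripos A I)
  tripos_le_refl tripos_le_anti tripos_le_trans.

Lemma predicate_le phi psi : (predicate phi <= predicate psi) = entails phi psi.
Proof. exact: tripos_leE. Qed.

Lemma tripos_lexI p q r : (p <= tripos_meet q r) = (p <= q) && (p <= r).
Proof.
rewrite -{1}(predicateK p) predicate_le entails_times.
by rewrite -!predicate_le !predicateK.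
Qed.

HB.instance Definition _ :=
  Order.POrder_isMeetSemilattice.Build d (tripos A I) tripos_lexI.

Lemma predicate_meet phi psi : predicate phi `&` predicate psi =
  predicate (fun i => times (phi i) (psi i)) :> tripos A I.
Proof.
have h p : (p <= predicate phi `&` predicate psi) =
           (p <= predicate (fun i => times (phi i) (psi i))).
  by rewrite -(predicateK p) lexI !predicate_le entails_times.
by apply: le_anti; rewrite h lexx -h lexx.
Qed.

End TriposOrder.

Section TriposMaps.
Context {d : Order.disp_t} {A : implicativeAlgebraType d}.

(* P_f *)
Definition pullback (I X : Type) (f : I -> X) (p : tripos A X) : tripos A I :=
  predicate (repr p \o f).

(* The left adjoint of P_f. *)
Definition exists_along (I X : Type) (f : I -> X) (p : tripos A I) : tripos A X :=
  predicate (fun x => exists_in (f @^-1` [set x]) (repr p)).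

Definition delta (X : Type) : tripos A (X * X) :=
  exists_along (fun x : X => (x, x)) (predicate (fun=> \top)).

Lemma exists_along_adj (I X : Type) (f : I -> X) p q :
  (exists_along f p <= q) = (p <= pullback f q).
Proof.
by rewrite -(predicateK q) predicate_le entails_exists -predicate_le !predicateK.
Qed.

Lemma pullback_predicate (I X : Type) (f : I -> X) (psi : X -> A) :
  pullback f (predicate psi) = predicate (psi \o f).
Proof.
apply: le_anti; rewrite !predicate_le.
have : predicate psi == predicate (repr (predicate psi)) by rewrite predicateK.
rewrite predicate_eq => /andP[/entailsP h /entailsP k].
by apply/andP; split; apply/entailsP;
  [apply: valid_reindex k | apply: valid_reindex h] => i; exists (f i).
Qed.

Lemma exists_along_predicate (I X : Type) (f : I -> X) (phi : I -> A) :
  exists_along f (predicate phi) =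
  predicate (fun x => exists_in (f @^-1` [set x]) phi).
Proof.
have h q : (exists_along f (predicate phi) <= q) =
           (predicate (fun x => exists_in (f @^-1` [set x]) phi) <= q).
  rewrite exists_along_adj -(predicateK q) pullback_predicate !predicate_le.
  by rewrite entails_exists.
by apply: le_anti; rewrite h lexx -h lexx.
Qed.

Definition functional (I J : Type) (phi : tripos A (I * J)) : Prop :=
  pullback (fun t : I * J * J => (t.1.1, t.1.2)) phi
    `&` pullback (fun t : I * J * J => (t.1.1, t.2)) phi
  <= pullback (fun t : I * J * J => (t.1.2, t.2)) (delta J).

Definition SKp (I : Type) (p : tripos A I) : Prop :=
  forall (J : Type) (f : J -> I) (psi : tripos A J),
    p <= exists_along f psi ->
    exists g : I -> J, p <= pullback g psi /\ f \o g = id.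

Definition fSKp (I : Type) (p : tripos A I) : Prop :=
  forall (J : Type) (phi : tripos A (I * J)), functional phi ->
    p <= exists_along fst phi ->
    exists! f : I -> J, p <= pullback (fun i => (i, f i)) phi.

Definition wfSKp (I : Type) (p : tripos A I) : Prop :=
  forall (J : Type) (phi : tripos A (I * J)), functional phi ->
    p <= exists_along fst phi ->
    exists f : I -> J, p <= pullback (fun i => (i, f i)) phi.

End TriposMaps.

(* Main.v *)
Require Import Defs.
From mathcomp Require Import ssreflect ssrfun ssrbool order.
From mathcomp Require Import eqtype generic_quotient boolp classical_sets.

(** The chosen representatives of existential quantification along a map and of
    the equality predicate agree on the nose with the families [exists_all] and
    [deltaA], since [exists_in D c] depends only on the set of values of [c] on
    [D]. Hence every clause about predicates unfolds to the corresponding clause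
    about families, a map [J -> I] being traded for the family of its fibres and
    a family of sets for the projection of its disjoint union. *)

Set Implicit Arguments.
Unset Strict Implicit.
Unset Printing Implicit Defensive.

Import Order.TTheory.
Local Open Scope classical_set_scope.
Local Open Scope order_scope.

Section Proposition.
Context {d : Order.disp_t} {A : implicativeAlgebraType d}.

Lemma exists_in_eq_image (I J : Type) (D : set I) (E : set J)
    (b : I -> A) (c : J -> A) :
  b @` D = c @` E -> exists_in D b = exists_in E c.
Proof.
move=> bc; rewrite /exists_in.
suff h x : (fun i => b i ~> x) @` D = (fun j => c j ~> x) @` E.
  by congr bigmeet; apply: eq_imagel => x _; rewrite h.
by rewrite -(image_comp b (imp^~ x)) bc image_comp.
Qed.

(** Lets a fibre serve as an index set, since [SK] quantifies over families indexed by whole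
    types. *)
Lemma exists_in_sig (J : Type) (D : set J) (c : J -> A) :
  exists_in D c = exists_all (fun j : {j | D j} => c (sval j)).
Proof.
apply: exists_in_eq_image; apply/seteqP; split=> _ [j Dj <-].
  by exists (exist _ j Dj).
by exists (sval j) => //; exact: svalP.
Qed.

Lemma exists_in_tag (I : Type) (J : I -> Type) (b : forall i, J i -> A) i :
  exists_in (@projT1 I J @^-1` [set i]) (fun s => b (projT1 s) (projT2 s)) =
  exists_all (b i).
Proof.
apply: exists_in_eq_image; apply/seteqP; split=> [_ [[k j] /= <- <-]|_ [j _ <-]].
  by exists j.
by exists (existT _ i j).
Qed.

Lemma exists_in_fst (I J : Type) (c : I * J -> A) i :
  exists_in (fst @^-1` [set i]) c = exists_all (fun j => c (i, j)).
Proof.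
apply: exists_in_eq_image; apply/seteqP; split=> [_ [[k j] /= <- <-]|_ [j _ <-]].
  by exists j.
by exists (i, j).
Qed.

(** The fibre of the diagonal over [(j, j')] is a singleton or empty: the inner meet is [\top ~> x]
    in the first case and the empty meet [\top] in the second. *)
Lemma exists_in_diag (J : Type) (j j' : J) :
  exists_in ((fun x : J => (x, x)) @^-1` [set (j, j')]) (fun=> \top) =
  deltaA j j' :> A.
Proof.
rewrite /deltaA /exists_in; case: pselect => /= [<-|jj'].
  congr bigmeet; apply: eq_imagel => x _; congr (_ ~> x).
  apply/eqP; rewrite eq_le; apply/andP; split.
    exact: (@bigmeet_in_lb _ _ _ _ (fun=> \top ~> x) j).
  by apply: bigmeet_in_glb.
(* As [imp] preserves meets in its second argument, [\top ~> \bot] becomes the meet of all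
   [\top ~> x]. *)
have bot_meet : \bot = \Meet_(x : A) x :> A.
  by apply/eqP; rewrite eq_le le0x /=; apply: (bigmeet_lb id \bot).
rewrite bot_meet imp_bigmeet; congr bigmeet; rewrite image_comp.
apply: eq_imagel => x _; congr (_ ~> x).
apply/eqP; rewrite eq_le lex1 /=; apply: bigmeet_in_glb => k [] kj kj'.
by case: jj'; rewrite -kj.
Qed.

Lemma deltaE (J : Type) :
  delta J = predicate (fun jj : J * J => deltaA jj.1 jj.2) :> tripos A (J * J).
Proof.
rewrite /delta exists_along_predicate; congr predicate.
by apply: funext => -[j j']; exact: exists_in_diag.
Qed.

(** The meet of predicates is the pointwise [times]; the meet over triples and the three nested
    meets bound each other, so upward closure of the separator gives both directions. *)
Lemma functionalE (I J : Type) (b : I * J -> A) :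
  functional (predicate b) <-> times_functional (fun i j => b (i, j)).
Proof.
rewrite /functional deltaE !pullback_predicate predicate_meet predicate_le.
split=> [/entailsP|h]; last apply/entailsP; [|move: h]; apply: separator_up.
  do 3![apply: bigmeet_glb => ?]; exact: (bigmeet_lb _ (_, _, _)).
apply: bigmeet_glb => -[[i j] j'] /=.
apply: le_trans (bigmeet_lb _ i) _; apply: le_trans (bigmeet_lb _ j) _.
exact: (bigmeet_lb _ j').
Qed.

Lemma predicate_le_exists (I J : Type) (f : J -> I) (phi : I -> A) (b : J -> A) :
  predicate phi <= exists_along f (predicate b) <->
  valid (fun i => phi i ~> exists_in (f @^-1` [set i]) b).
Proof. by rewrite exists_along_predicate predicate_le; split=> /entailsP. Qed.

Lemma predicate_le_exists_fst (I J : Type) (phi : I -> A) (b : I * J -> A) :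
  predicate phi <= exists_along fst (predicate b) <->
  valid (fun i => phi i ~> exists_all (fun j => b (i, j))).
Proof.
have -> : (fun i => phi i ~> exists_all (fun j => b (i, j))) =
          (fun i => phi i ~> exists_in (fst @^-1` [set i]) b).
  by apply: funext => i; rewrite exists_in_fst.
exact: predicate_le_exists.
Qed.

Lemma predicate_le_pullback (I J : Type) (f : I -> J) (phi : I -> A) (b : J -> A) :
  predicate phi <= pullback f (predicate b) <->
  valid (fun i => phi i ~> b (f i)).
Proof. by rewrite pullback_predicate predicate_le; split=> /entailsP. Qed.

Lemma SKpE (I : Type) (phi : I -> A) : SKp (predicate phi) <-> SK phi.
Proof.
split=> [h J b hb|h J f psi].
  have [|g [/predicate_le_pullback hg fg]] :=
      h _ (@projT1 I J) (predicate (fun s => b (projT1 s) (projT2 s))).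
    apply/predicate_le_exists.
    by apply: valid_le hb => i; rewrite exists_in_tag.
  have gi i : projT1 (g i) = i by have := congr1 (@^~ i) fg.
  (* [projT2 (g i)] lies in [J (projT1 (g i))]; the section equation [gi i] transports it to [J i].
     Once [g i] is generalized, destructing that equation removes the transport. *)
  exists (fun i => eq_rect _ J (projT2 (g i)) _ (gi i)).
  by apply: valid_le hg => i /=; move: (g i) (gi i) => [k j] /= ki; case: _ / ki.
rewrite -(predicateK psi) => /predicate_le_exists hpsi.
(* With the fibres of [f] as index sets, any choice function is a section of [f]. *)
have [|g hg] := h (fun i => {j | f j = i}) (fun i j => repr psi (sval j)).
  by apply: valid_le hpsi => i; rewrite exists_in_sig.
exists (fun i => sval (g i)); split; first exact/predicate_le_pullback.
by apply: funext => i /=; exact: svalP (g i).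
Qed.

(** An arbitrary [Q] covers [exists] and [exists!] at once: both sides apply it to the same property
    of maps [I -> J], up to currying. *)
Lemma functional_quantifierE
    (Q : forall T : Type, (T -> Prop) -> Prop) (I : Type) (phi : I -> A) :
  (forall (J : Type) (p : tripos A (I * J)), functional p ->
    predicate phi <= exists_along fst p ->
    Q (I -> J) (fun f => predicate phi <= pullback (fun i => (i, f i)) p)) <->
  (forall (J : Type) (b : I -> J -> A), times_functional b ->
    valid (fun i => phi i ~> exists_all (b i)) ->
    Q (I -> J) (fun f => valid (fun i => phi i ~> b i (f i)))).
Proof.
(* An equality, not just a pointwise equivalence, is what can be rewritten under the abstract
   [Q]. *)
have graphE J (b : I * J -> A) :
    (fun f : I -> J =>
       predicate phi <= pullback (fun i => (i, f i)) (predicate b) : Prop) =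
    (fun f => valid (fun i => phi i ~> b (i, f i))).
  by apply: funext => f; apply: propext; exact: predicate_le_pullback.
split=> h J.
  move=> b fb hb; have := h J (predicate (fun ij => b ij.1 ij.2)).
  by rewrite graphE; apply; [exact/functionalE | exact/predicate_le_exists_fst].
move=> p; rewrite -(predicateK p) graphE => /functionalE fp.
by move=> /predicate_le_exists_fst; exact: h fp.
Qed.

End Proposition.

Theorem proposition4p10 (d : Order.disp_t) (A : implicativeAlgebraType d)
    (I : Type) (phi : I -> A) :
  [/\ SKp (predicate phi) <-> SK phi,
      fSKp (predicate phi) <-> fSK phi
    & wfSKp (predicate phi) <-> wfSK phi].
Proof.
split; first exact: SKpE.
  exact: (functional_quantifierE (fun T P => exists! x : T, P x)).
exact: (functional_quantifierE (fun T P => exists x : T, P x)).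
Qed.
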